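(* Let $\mathbf{G}(\lambda)$ be a real-rational (possibly improper) scalar transfer function, given by a minimal centred realisation $(A,B,C,D,E)_{\lambda_0}$ of order $n=\delta(\mathbf{G})$, where $\lambda_0\in\mathbb{R}$ is not a pole of $\mathbf{G}(\lambda)$. Let $\nu$ be a positive integer with $\nu<n$, let $\alpha>0$ and $n_1,\dots,n_\alpha>0$ be integers with $\sum_{i=1}^{\alpha}n_i=\nu$, and let $\mu_1,\dots,\mu_\alpha\in\overline{\mathbb{C}}\setminus\{\lambda_0\}$ be distinct points with $\mu_i\notin\Lambda(A-\lambda E)$ for all $i$. Assume that there exist $i\in\{1,\dots,\alpha\}$ and $j\in\{0,\dots,n_i-1\}$ such that $\eta_{\mathbf{G},j}(\mu_i)\neq0$. Consider any $S\in\mathbb{R}^{\nu\times\nu}$ which is similar to $J:=\mathrm{Jord}(\mathfrak{f}(\mu_1),n_1,\dots,\mathfrak{f}(\mu_\alpha),n_\alpha)$ and any row vector $L\in\mathbb{R}^{1\times\nu}$ such that the pair $(L,S)$ is observable. Then: (a) There exists a unique $\Pi\in\mathbb{R}^{n\times\nu}$ solving the generalised Sylvester equation $$E\Pi+BL=(A-\lambda_0E)\Pi S.$$ (b) For any column vector $G\in\mathbb{R}^{\nu}$ such that $\mathfrak{f}(\mu_i)\notin\Lambda(S-GL-\lambda I_\nu)$ for all $i\in\{1,\dots,\alpha\}$, the transfer function $\mathbf{H}(\lambda)$ with centred realisation $$\big(I_\nu+\lambda_0(S-GL),\;G,\;C\Pi,\;D,\;S-GL\big)_{\lambda_0},$$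 that is, $$\mathbf{H}(\lambda)=C\Pi\big(\lambda(S-GL)-I_\nu-\lambda_0(S-GL)\big)^{-1}G(\lambda_0-\lambda)+D,$$ is well-defined and satisfies $$\eta_{\mathbf{G},j}(\mu_i)=\eta_{\mathbf{H},j}(\mu_i)\quad\text{for all } i\in\{1,\dots,\alpha\},\ j\in\{0,\dots,n_i-1\}.$$
   Context: $\overline{\mathbb{C}}:=\mathbb{C}\cup\{\infty\}$. A transfer function is a real-rational function of the complex indeterminate $\lambda$. If $\mathbf{G}=b/a$ with $a,b$ coprime real polynomials, its McMillan degree is $\delta(\mathbf{G}):=\max\{\deg a,\deg b\}$; its finite poles are the roots of $a$, and $\infty$ is a pole of $\mathbf{G}(\lambda)$ if $0$ is a pole of $\mathbf{G}(1/\lambda)$. Centred realisations: for $\lambda_0\in\mathbb{C}$, a realisation of order $n$ centred at $\lambda_0$ of $\mathbf{G}(\lambda)$, denoted $(A,B,C,D,E)_{\lambda_0}$, consists of real matrices $A,E\in\mathbb{R}^{n\times n}$, $B,C^\top\in\mathbb{R}^n$, $D\in\mathbb{R}$ with $\det(A-\lambda E)\not\equiv0$ and $\mathbf{G}(\lambda)=C(\lambda E-A)^{-1}B(\lambda_0-\lambda)+D$. (For $\lambda_0=\infty$: $\mathbf{G}(\lambda)=C(\lambda E-A)^{-1}B+D$.) A centred realisation is minimal if its order is no greater than that of any other centred realisation of the same transfer function, regardless of centring points; equivalently, if its order equals $\delta(\mathbf{G})$. ''Well-defined'' for a transfer function given by a centred realisation means that its pole pencil (the pencil $A-\lambda E$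 of the realisation) has determinant not identically zero. For matrices $M,N$ of the same size, $\Lambda(M-\lambda N)\subseteq\overline{\mathbb{C}}$ denotes the set of generalised eigenvalues of the pencil; for a square pencil with $\det(M-\lambda N)\not\equiv0$ these are the finite roots of $\det(M-\lambda N)$, together with $\infty$ if $\det N=0$. Möbius map: $\mathfrak{f}:\overline{\mathbb{C}}\to\overline{\mathbb{C}}$, $\mathfrak{f}(\lambda):=\frac{1}{\lambda-\lambda_0}$, with $\mathfrak{f}(\infty)=0$, $\mathfrak{f}(\lambda_0)=\infty$. $\mathrm{Jord}(\theta_1,n_1,\dots,\theta_q,n_q)$ denotes the block-diagonal matrix in Jordan canonical form whose Jordan block associated with $\theta_i\in\mathbb{C}$ is of size $n_i\times n_i$. Similarity is over $\mathbb{C}$. A pair $(L,S)$ with $L\in\mathbb{R}^{1\times\nu}$, $S\in\mathbb{R}^{\nu\times\nu}$ is observable if $\mathrm{rank}\begin{bmatrix}L^\top & S^\top L^\top&\cdots&(S^\top)^{\nu-1}L^\top\end{bmatrix}=\nu$. Moments: for $\mu\in\overline{\mathbb{C}}$ not a pole of $\mathbf{G}(\lambda)$, the $i$-th order moment of $\mathbf{G}$ at $\mu$ is $\eta_{\mathbf{G},i}(\mu):=\frac{(-1)^i}{i!}\mathbf{G}^{(i)}(\mu)$, where $\mathbf{G}^{(i)}$ is the $i$-th derivative with respect to $\lambda$; at $\mu=\infty$ the value is understood as the limit for $\lambda\to\infty$. *)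

(* Defs.v *)
From HB Require Import structures.
From mathcomp Require Import all_boot all_order all_algebra.
From mathcomp Require Import fraction complex.
From mathcomp Require Import all_classical all_reals all_analysis.

Set Implicit Arguments.
Unset Strict Implicit.
Unset Printing Implicit Defensive.

Import Order.TTheory GRing.Theory Num.Theory.
Import numFieldNormedType.Exports.

Local Open Scope classical_set_scope.
Local Open Scope ring_scope.
Local Open Scope complex_scope.

Notation ratfun F := {fraction {poly F}}.
Local Notation "x %:F" := (FracField.tofrac x) : ring_scope.

(* The Riemann sphere: None is the point at infinity. *)
Notation ccomplex R := (option R[i]).

Section RationalFunctions.
Variable F : fieldType.
Implicit Types G h : ratfun F.

Definition rnum G : {poly F} :=
  let x := frac (repr G) in x.1 %/ gcdp x.1 x.2.

Definition rden G : {poly F} :=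
  let x := frac (repr G) in x.2 %/ gcdp x.1 x.2.

Lemma rden_neq0 G : rden G != 0.
Proof.
have d0 := denom_ratioP (repr G).
by rewrite /rden dvdp_div_eq0 ?dvdp_gcdr.
Qed.

Lemma ratfunE G : G = (rnum G)%:F / (rden G)%:F.
Proof.
set x := repr G; set n := (frac x).1; set d := (frac x).2.
have d0 : d != 0 by exact: denom_ratioP.
have En : n = rnum G * gcdp n d by rewrite /rnum divpK // dvdp_gcdl.
have Ed : d = rden G * gcdp n d by rewrite /rden divpK // dvdp_gcdr.
have g0 : gcdp n d != 0 by rewrite gcdp_eq0 negb_and d0 orbT.
have : G * d%:F = n%:F.
  rewrite -[G]reprK -/x; unlock FracField.tofrac.
  rewrite -[LHS]/(FracField.mul _ _) !piE.
  apply/eqmodP; rewrite /= FracField.equivfE /FracField.mulf.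
  by rewrite !numden_Ratio ?mulf_neq0 ?oner_neq0 // !mulr1 mulrC.
rewrite Ed tofracM mulrA [in RHS]En tofracM => /mulIf GE.
by rewrite -GE ?mulfK ?tofrac_eq0 ?rden_neq0.
Qed.

Lemma coprimep_rnum_rden G : coprimep (rnum G) (rden G).
Proof. by rewrite coprimep_div_gcd // denom_ratioP orbT. Qed.

Definition mcmillan G : nat := maxn (size (rden G)).-1 (size (rnum G)).-1.

(* Composition G(h); the denominator does not vanish when h is not constant. *)
Definition rsubst G h : ratfun F :=
  (map_poly (fun c => c%:P%:F) (rnum G)).[h] /
  (map_poly (fun c => c%:P%:F) (rden G)).[h].

Definition regular_pencil n (A E : 'M[F]_n) : bool :=
  \det (map_mx polyC A - 'X *: map_mx polyC E) != 0.

(* C (lambda E - A)^-1 B (lambda0 - lambda) + D for c = Some lambda0, and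
   C (lambda E - A)^-1 B + D for c = None; meaningful for regular pencils. *)
Definition centred_tf n (c : option F) (A : 'M[F]_n) (B : 'cV[F]_n)
    (C : 'rV[F]_n) (D : F) (E : 'M[F]_n) : ratfun F :=
  let cst (x : F) : ratfun F := x%:P%:F in
  let lambda : ratfun F := 'X%:F in
  (map_mx cst C *m invmx (lambda *: map_mx cst E - map_mx cst A)
    *m map_mx cst B) 0 0 *
    (if c is Some lambda0 then cst lambda0 - lambda else 1) + cst D.

Definition jordan_block (theta : F) k : 'M[F]_k :=
  \matrix_(i, j) (theta *+ (i == j) + (i.+1 == j :> nat)%:R).

Definition Jord q (theta : 'I_q -> F) (n_ : 'I_q -> nat) :
    'M[F]_(\sum_i n_ i) :=
  \mxdiag_i jordan_block (theta i) (n_ i).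

Definition observable nu (L : 'rV[F]_nu) (S : 'M[F]_nu) : bool :=
  \rank (\matrix_(i < nu, k < nu) ((S^T ^+ k : 'M[F]_nu) *m L^T) i 0) == nu.

End RationalFunctions.

Section TransferFunctions.
Variable R : realType.
Implicit Types (G : ratfun R) (mu : ccomplex R).

Local Notation toC := (real_complex R).

Definition complexify G : ratfun R[i] :=
  (map_poly toC (rnum G))%:F / (map_poly toC (rden G))%:F.

Definition evalC G (z : R[i]) : R[i] :=
  (map_poly toC (rnum G)).[z] / (map_poly toC (rden G)).[z].

Definition is_pole G mu : bool :=
  match mu with
  | Some z => root (map_poly toC (rden G)) z
  | None => root (rden (rsubst G ('X%:F)^-1)) 0
  end.

(* The centre may be a non-real complex number although the matrices are real,
   hence an identity between rational functions over R[i]. *)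
Definition realisation n G (c : ccomplex R) (A : 'M[R]_n) (B : 'cV[R]_n)
    (C : 'rV[R]_n) (D : R) (E : 'M[R]_n) : Prop :=
  regular_pencil A E /\
  complexify G = centred_tf c (map_mx toC A) (map_mx toC B) (map_mx toC C)
                   (toC D) (map_mx toC E).

Definition minimal_realisation n G (c : ccomplex R) (A : 'M[R]_n)
    (B : 'cV[R]_n) (C : 'rV[R]_n) (D : R) (E : 'M[R]_n) : Prop :=
  realisation G c A B C D E /\
  forall m c' (A' : 'M[R]_m) (B' : 'cV[R]_m) (C' : 'rV[R]_m) (D' : R)
      (E' : 'M[R]_m),
    realisation G c' A' B' C' D' E' -> (n <= m)%N.

(* Only meaningful for regular square pencils. *)
Definition gen_eigenvalue n (M N : 'M[R]_n) mu : bool :=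
  match mu with
  | Some z => \det (map_mx toC M - z *: map_mx toC N) == 0
  | None => \det N == 0
  end.

Definition moebius (lambda0 : R[i]) mu : ccomplex R :=
  match mu with
  | Some z => if z == lambda0 then None else Some (z - lambda0)^-1
  | None => Some 0
  end.

Definition complex_infty : set_system R[i]^o :=
  [set P | exists M : R, forall z : R[i], toC M < `|z| -> P z].

Global Instance complex_infty_filter : ProperFilter complex_infty.
Proof.
apply: Build_ProperFilter_ex.
  move=> P [M PM]; exists (toC (`|M| + 1)); apply: PM.
  by rewrite normc_def /= expr0n addr0 sqrtr_sqr ltcR
     (ger0_norm (addr_ge0 _ _)) // (le_lt_trans (ler_norm M)) // ltrDl.
split.
- by exists 0.
- move=> P Q [M PM] [N QN]; exists (Num.max M N) => z.
  by move=> zMN; split; [apply: PM|apply: QN];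
     apply: le_lt_trans zMN; rewrite lecR le_max lexx ?orbT.
- by move=> P Q PQ [M PM]; exists M => z zM; apply/PQ/PM.
Qed.

(* derive1n over the field R[i] is the iterated complex derivative; R[i]^o is
   R[i] seen as a normed space over itself. Only meaningful off the poles. *)
Definition moment G (k : nat) mu : R[i] :=
  let eta (z : R[i]^o) : R[i]^o :=
    (-1) ^+ k / k`!%:R * derive1n k (evalC G : R[i]^o -> R[i]^o) z in
  match mu with
  | Some z => eta z
  | None => lim (eta z @[z --> complex_infty])
  end.

End TransferFunctions.

(* Main.v *)
Require Import Defs.
From HB Require Import structures.
From mathcomp Require Import all_boot all_order all_algebra.
From mathcomp Require Import fraction complex.
From mathcomp Require Import all_classical all_reals all_analysis.
From mathcomp Require Import ring zify.

(** Put [s = 1 / (lambda - lambda0)] and [M = A - lambda0 E].  In the variable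
    [s] the two transfer functions are [D + C (s M - E)^-1 B] and
    [D + C Pi (s - F)^-1 Gv] with [F = S - Gv L], so the centring disappears.
    The Sylvester equation reads [(s M - E) Pi = M Pi (s - S) + B L], whence
      [G - H = C (s M - E)^-1 (B - M Pi Gv) * det (s - S) / det (s - F)].
    The zeros of [det (s - S)] are the [f (mu_i)] with multiplicities [n_i], and
    the two denominators do not vanish there, so [G - H] vanishes to order [n_i]
    at [mu_i].  At infinity only the value matters: with the limit convention
    the higher derivatives of a proper function have zero limit.  Cleared of
    denominators the identity is one between polynomials in [lambda], and
    [det (s - S)] becomes [det ((lambda - lambda0) S - 1)]. *)

Set Implicit Arguments.
Unset Strict Implicit.
Unset Printing Implicit Defensive.

Import Order.TTheory GRing.Theory Num.Theory.
Import numFieldNormedType.Exports.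

Local Open Scope ring_scope.
Local Open Scope complex_scope.

Local Notation "x %:F" := (FracField.tofrac x) : ring_scope.

(** * Rank-one updates and the interpolation error *)

(** The bordered matrix [M] is made triangular in two ways: by a unipotent factor on the left, and
    by a factor built from [\adj Q] on the right. Adjugates instead of inverses keep this valid over
    polynomials; [\det Q != 0] allows cancelling [\det Q ^+ n]. *)
Lemma det_rank1_update (K : idomainType) n (Q : 'M[K]_n) (u : 'cV_n)
    (v : 'rV_n) :
  \det Q != 0 -> \det (Q + u *m v) = \det Q + (v *m \adj Q *m u) 0 0.
Proof.
move=> Q0; have adjn : \det (\adj Q) * \det Q = \det Q ^+ n.
  by rewrite -det_mulmx mul_adj_mx det_scalar.
pose M := block_mx Q (- u) v 1%:M.
have detM : \det M = \det (Q + u *m v).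
  have <- : \det (block_mx 1%:M u 0 1%:M *m M) = \det M.
    by rewrite det_mulmx det_ublock !det1 !mul1r.
  rewrite mulmx_block !mul1mx !mul0mx !mulmx1 !add0r addNr.
  by rewrite det_lblock det1 mulr1.
have : \det M * \det (block_mx (\adj Q) (\adj Q *m u) 0 (\det Q)%:M) =
    \det Q ^+ n * (\det Q + (v *m \adj Q *m u) 0 0).
  rewrite -det_mulmx mulmx_block !mulmx0 !mulmxA mul_mx_adj !mul1mx !addr0.
  rewrite mulNmx -!scalar_mxC subrr det_lblock det_scalar; congr (_ * _).
  by rewrite (mx11_scalar (_ + _)) det_scalar expr1 !mxE eqxx mulr1n addrC.
rewrite det_ublock det_scalar expr1 adjn mulrC.
by move=> /(mulfI (expf_neq0 _ Q0)) <-.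
Qed.

(* [P] and [Q] are the pole pencils of the two systems, with
   [w = lambda - lambda0]; the constant term [D] cancels and a common factor [- w]
   has been dropped. *)
Lemma interpolation_error (K : idomainType) n nu (w : K) (M E : 'M[K]_n)
    (B : 'cV_n) (C : 'rV_n) (S : 'M[K]_nu) (L : 'rV_nu) (Gv : 'cV_nu)
    (Pi : 'M[K]_(n, nu)) (P := w *: E - M) (Q := w *: (S - Gv *m L) - 1%:M) :
  E *m Pi + B *m L = M *m Pi *m S -> \det Q != 0 ->
  (C *m \adj P *m B) 0 0 * \det Q - (C *m Pi *m \adj Q *m Gv) 0 0 * \det P =
  (C *m \adj P *m (B - M *m Pi *m Gv)) 0 0 * \det (w *: S - 1%:M).
Proof.
move=> sylv Q0; pose Sg := w *: S - 1%:M.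
have SgE : Sg = Q + (w *: Gv) *m L.
  by rewrite /Sg /Q scalerBr -scalemxAl addrAC subrK.
(* The Sylvester equation carries [Pi] from the large pencil to the small one, up to a term that
   factors through [L]. *)
have PPi : P *m Pi = M *m Pi *m Sg - w *: (B *m L).
  rewrite /P /Sg mulmxBl -scalemxAl mulmxBr mulmx1 -scalemxAr -sylv scalerDr.
  by rewrite [RHS]addrAC addrK.
have detSg : \det Sg = \det Q + w * (L *m \adj Q *m Gv) 0 0.
  by rewrite SgE det_rank1_update // -scalemxAr; congr (_ + _); rewrite mxE.
have mxB (X Y : 'M[K]_1) : (X - Y) 0 0 = X 0 0 - Y 0 0 by rewrite !mxE.
have mxZ c (X : 'M[K]_1) : (c *: X) 0 0 = c * X 0 0 by rewrite mxE.
rewrite -/Sg detSg.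
set x := (C *m \adj P *m B) 0 0; set y := (C *m \adj P *m (M *m Pi *m Gv)) 0 0.
set t := (L *m \adj Q *m Gv) 0 0.
have -> : (C *m \adj P *m (B - M *m Pi *m Gv)) 0 0 = x - y.
  by rewrite mulmxBr mxB.
(* [Sg] differs from [Q] by a rank-one matrix whose columns are proportional to [Gv], so
   [Sg *m \adj Q] multiplies [Gv] by the scalar [\det Sg]. *)
have SgQ : Sg *m \adj Q *m Gv = (\det Q + w * t) *: Gv.
  rewrite SgE mulmxDl mul_mx_adj mulmxDl mul_scalar_mx -!scalemxAl.
  rewrite -!mulmxA [L *m _]mx11_scalar mul_mx_scalar.
  by rewrite scalerA -scalerDl mulmxA.
suff -> : (C *m Pi *m \adj Q *m Gv) 0 0 * \det P =
    (\det Q + w * t) * y - w * (x * t).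
  ring.
have -> : (C *m Pi *m \adj Q *m Gv) 0 0 * \det P =
    (C *m \adj P *m ((P *m Pi) *m \adj Q *m Gv)) 0 0.
  by rewrite !mulmxA -[C *m _ *m P]mulmxA mul_adj_mx mul_mx_scalar -!scalemxAl
    mxZ mulrC.
have SgQE : M *m Pi *m Sg *m \adj Q *m Gv = (\det Q + w * t) *: (M *m Pi *m Gv).
  by rewrite -!mulmxA [Sg *m _]mulmxA SgQ -!scalemxAr.
have BLE : B *m L *m \adj Q *m Gv = t *: B.
  by rewrite -!mulmxA [L *m _]mx11_scalar mul_mx_scalar mulmxA.
by rewrite PPi !mulmxBl SgQE -!scalemxAl BLE mulmxBr -!scalemxAr mxB !mxZ
  [x * t]mulrC.
Qed.

(** * Pencils of Jordan matrices and injectivity of the Sylvester operator *)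

Lemma det_castmx (K : comNzRingType) m n (e : m = n) (M : 'M[K]_m) :
  \det (castmx (e, e) M) = \det M.
Proof. by case: n / e; rewrite castmx_id. Qed.

Lemma det_mxdiag (K : comNzRingType) q (p_ : 'I_q -> nat)
    (B_ : forall i, 'M[K]_(p_ i)) :
  \det (\mxdiag_i B_ i) = \prod_i \det (B_ i).
Proof.
elim: q p_ B_ => [|q IHq] p_ B_.
  have size0 : (\sum_i p_ i = 0)%N by rewrite big_ord0.
  by rewrite [RHS]big_ord0 -(det_castmx size0) det_mx00.
by rewrite mxdiag_recl [RHS]big_ord_recl -IHq det_castmx det_ublock.
Qed.

(** Two coefficients cover both uses: [a = -1], [b = - 'X] give the characteristic polynomial, and
    [a = 'X - l0%:P], [b = 1] give the determinant in the interpolation error. *)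
Lemma det_Jord_pencil (K : fieldType) (T : comNzRingType)
    (phi : {rmorphism K -> T}) q (theta : 'I_q -> K) (n_ : 'I_q -> nat)
    (a b : T) :
  \det (a *: map_mx phi (Jord theta n_) - b%:M) =
  \prod_i (a * phi (theta i) - b) ^+ n_ i.
Proof.
pose B_ i := a *: map_mx phi (jordan_block (theta i) (n_ i)) - b%:M.
have -> : a *: map_mx phi (Jord theta n_) - b%:M = \mxdiag_i B_ i.
  rewrite mxdiagB mxdiagZ; congr (_ - _); apply/matrixP => i j.
  rewrite !mxE; case: eqP => [e|_]; last by rewrite !mxE rmorph0 mulr0.
  by case: _ / e (tagnat.sig2 j) => k; rewrite !conform_mx_id !mxE.
(* Jordan blocks are upper triangular and [det_trig] is about lower triangular matrices, hence the
   transpose. *)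
rewrite det_mxdiag; apply: eq_bigr => i _; rewrite -det_tr det_trig.
  rewrite -[n_ i in RHS]card_ord -prodr_const; apply: eq_bigr => j _.
  by rewrite !mxE eqxx mulr1n gtn_eqF // addr0.
apply/is_trig_mxP => j k jk.
rewrite !mxE -!val_eqE /= (gtn_eqF jk) gtn_eqF ?leqW //.
by rewrite !mulr0n addr0 rmorph0 mulr0 subr0.
Qed.

Lemma det_similar_Jord_pencil (K : fieldType) (T : comNzRingType)
    (phi : {rmorphism K -> T}) q (theta : 'I_q -> K) (n_ : 'I_q -> nat) nu
    (e : (\sum_i n_ i)%N = nu) (S : 'M[K]_nu) (a b : T) :
  S ~_{in unitmx} castmx (e, e) (Jord theta n_) ->
  \det (a *: map_mx phi S - b%:M) = \prod_i (a * phi (theta i) - b) ^+ n_ i.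
Proof.
case=> P Pu /(simmxP Pu) PS; rewrite -det_Jord_pencil -(det_castmx e).
have PVP : map_mx phi (invmx P) *m map_mx phi P = 1%:M.
  by rewrite -map_mxM mulVmx // map_mx1.
have -> : castmx (e, e) (a *: map_mx phi (Jord theta n_) - b%:M) =
    a *: map_mx phi (castmx (e, e) (Jord theta n_)) - b%:M.
  by case: nu / e {S P Pu PS PVP}; rewrite !castmx_id.
set J := map_mx phi (castmx _ _).
have PVJP : map_mx phi (invmx P) *m J *m map_mx phi P = map_mx phi S.
  by rewrite -!map_mxM -[_ *m _ *m P]mulmxA -PS mulKmx.
have -> : a *: map_mx phi S - b%:M =
    map_mx phi (invmx P) *m ((a *: J - b%:M) *m map_mx phi P).
  rewrite mulmxBl mulmxBr -scalemxAl -scalemxAr (mulmxA _ J) PVJP.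
  by rewrite mulmxA scalar_mxC -mulmxA PVP mulmx1.
by rewrite !det_mulmx mulrCA -det_mulmx PVP det1 mulr1.
Qed.

Lemma char_poly_similar_Jord (K : fieldType) q (theta : 'I_q -> K)
    (n_ : 'I_q -> nat) nu (e : (\sum_i n_ i)%N = nu) (S : 'M[K]_nu) :
  S ~_{in unitmx} castmx (e, e) (Jord theta n_) ->
  char_poly S = \prod_i ('X - (theta i)%:P) ^+ n_ i.
Proof.
move=> /(@det_similar_Jord_pencil _ _ polyC _ _ _ _ _ _ (-1) (- 'X)) detS.
have -> : char_poly S = \det (-1 *: map_mx polyC S - (- 'X)%:M).
  by congr (\det _); rewrite scaleN1r raddfN opprK addrC.
by rewrite detS; apply: eq_bigr => i _; rewrite mulN1r opprK addrC.
Qed.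

(* For [s] off the spectrum of the pencil, right multiplication by [S - s] is
   injective on the solutions of the homogeneous equation, which it preserves;
   by Cayley-Hamilton a product of such maps vanishes. *)
Lemma sylvester_injective (K : fieldType) n nu (E M : 'M[K]_n) (S : 'M[K]_nu)
    q (theta : 'I_q -> K) (n_ : 'I_q -> nat) (X : 'M[K]_(n, nu)) :
  char_poly S = \prod_i ('X - (theta i)%:P) ^+ n_ i ->
  (forall i, \det (theta i *: M - E) != 0) ->
  E *m X = M *m X *m S -> X = 0.
Proof.
case: nu S X => [|nu] S X charS regE EX; first exact: thinmx0.
have stepS p (Y : 'M[K]_(n, nu.+1)) :
    E *m Y = M *m Y *m S -> E *m (Y *m horner_mx S p) =
    M *m (Y *m horner_mx S p) *m S.
  move=> EY; rewrite mulmxA EY -!mulmxA; congr (M *m (Y *m _)).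
  exact: esym (comm_horner_mx _ (erefl _)).
(* If [Y *m S = s *: Y], the homogeneous equation becomes [(s *: M - E) *m Y = 0], with an
   invertible left factor. *)
have inj1 s (Y : 'M[K]_(n, nu.+1)) : \det (s *: M - E) != 0 ->
    E *m Y = M *m Y *m S -> Y *m horner_mx S ('X - s%:P) = 0 -> Y = 0.
  move=> regs EY; rewrite rmorphB /= horner_mx_X horner_mx_C mulmxBr.
  move=> /subr0_eq YS; apply: (can_inj (mulKmx _)).
    by rewrite unitmxE unitfE; exact: regs.
  rewrite mulmx0 mulmxBl EY -mulmxA YS mul_mx_scalar -scalemxAl -scalemxAr.
  exact: subrr.
have injn s k (Y : 'M[K]_(n, nu.+1)) : \det (s *: M - E) != 0 ->
    E *m Y = M *m Y *m S -> Y *m horner_mx S (('X - s%:P) ^+ k) = 0 -> Y = 0.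
  move=> regs; elim: k Y => [|k IHk] Y EY.
    by rewrite expr0 rmorph1 mulmx1.
  rewrite exprS rmorphM mulmxA => /IHk YS.
  by apply: (inj1 s) => //; apply: YS; apply: stepS.
have : X *m horner_mx S
    (\prod_(i <- index_enum 'I_q) ('X - (theta i)%:P) ^+ n_ i) = 0.
  by rewrite -charS Cayley_Hamilton mulmx0.
(* The product is generalised to an arbitrary list of indices, so that its factors can be stripped
   off one at a time. *)
elim: (index_enum _) X EX => [|i r IHr] Y EY.
  by rewrite big_nil rmorph1 mulmx1.
rewrite big_cons rmorphM mulmxA => /IHr YS.
by apply: (injn (theta i) (n_ i)) => //; apply: YS; apply: stepS.
Qed.

(** * Derivatives of rational functions *)

Section RationalDerivative.
Variable K : numFieldType.
Implicit Types (p d : {poly K}).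

(* The numerator of the [k]-th derivative of [p / d] over [d ^+ k.+1]; for fixed
   [d] it is linear in [p]. *)
Fixpoint derive_num d p k : {poly K} :=
  if k is k'.+1 then
    (derive_num d p k')^`() * d - (derive_num d p k' * d^`()) *+ k'.+1
  else p.

Lemma derive_numB d p q k :
  derive_num d (p - q) k = derive_num d p k - derive_num d q k.
Proof.
by elim: k => //= k ->; rewrite derivB !mulrBl mulrnBl !opprD !opprK addrACA.
Qed.

(** Each step of the recursion costs at most one factor ['X - a%:P]: the derivative loses one, the
    other term none. *)
Lemma dvdp_derive_num d p (a : K) m k :
  ('X - a%:P) ^+ (m + k) %| p -> ('X - a%:P) ^+ m %| derive_num d p k.
Proof.
elim: k m => [|k IHk] m; first by rewrite addn0.
rewrite addnS -addSn => /IHk /= /dvdpP[q ->].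
rewrite dvdp_sub //.
  apply: dvdp_mulr; rewrite derivM deriv_exp derivB derivX derivC subr0 mul1r.
  by rewrite dvdp_add // ?dvdp_mull // ?exprS ?dvdp_mull //
    -mulr_natl ?dvdp_mull.
by rewrite -mulr_natl dvdp_mull // dvdp_mulr // dvdp_mull // exprS dvdp_mull.
Qed.

(** The term [k == 0] separates two cases: for positive [k] the degree is strictly below that of
    [d ^+ k.+1], so higher derivatives of a proper function vanish at infinity. *)
Lemma size_derive_num d p k :
  d != 0 -> (size p <= size d)%N ->
  (size (derive_num d p k) <= (size d).-1 * k.+1 + (k == 0))%N.
Proof.
move=> d0 spd; have sd : (0 < size d)%N by rewrite size_poly_gt0.
(* The induction uses only the second bound, uniform in [k]; its step yields the sharper first
   one. *)
suff : (size (derive_num d p k) <= (size d).-1 * k.+1 + (k == 0))%N /\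
  (size (derive_num d p k) <= ((size d).-1 * k.+1).+1)%N by case.
elim: k => [|k [_ IHk]] /=; first by rewrite muln1 addn1 prednK.
set q := derive_num d p k in IHk *.
suff sq : (size (q^`() * d - (q * d^`()) *+ k.+1)%R
    <= (size d).-1 * k.+2)%N by rewrite addn0; split=> //; exact: leqW.
have [->|q0] := eqVneq q 0.
  by rewrite deriv0 !mul0r mul0rn subr0 size_poly0.
have sdd := lt_size_deriv d0; have sqq := lt_size_deriv q0.
apply: leq_trans (size_polyD _ _) _; rewrite geq_max size_polyN.
rewrite -scaler_nat.
apply/andP; split.
  apply: leq_trans (size_polyMleq _ _) _; rewrite mulnS; lia.
apply: leq_trans (size_scale_leq _ _) _.
apply: leq_trans (size_polyMleq _ _) _; rewrite mulnS.
by move: IHk sdd sd; move: (size q) (size d^`()) (size d) => *; lia.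
Qed.

Lemma is_derive_horner p (x : K) :
  is_derive x (1 : K) (horner p : K -> K^o) p^`().[x].
Proof.
elim/poly_ind: p => [|p c IHp].
  rewrite deriv0 horner0 (_ : horner 0 = cst (0 : K)); last first.
    by apply/funext => y; rewrite horner0.
  exact: is_derive_cst.
rewrite (_ : horner _ = (horner p : K -> K^o) * id + cst c); last first.
  by apply/funext => y; rewrite !hornerE.
rewrite derivD derivC addr0 derivM derivX mulr1 !hornerE.
apply: is_derive_eq.
by rewrite addr0 addrC [X in X + _]mulrC [p.[x] *: 1]mulr1.
Qed.

Lemma near_horner_neq0 d (z : K) : d.[z] != 0 -> \forall x \near z, d.[x] != 0.
Proof.
move=> d0.
have [/derivable1_diffP/differentiable_continuous cd _] := is_derive_horner d z.
exact: cvgr_neq0 cd d0.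
Qed.

Lemma quotient_rule_step (a a' b b' : K) k : b != 0 ->
  a * (k.+1%:R * b^-1 ^+ k * (- b ^- 2 * b')) + b^-1 ^+ k.+1 * a' =
  (a' * b - (a * b') *+ k.+1) / b ^+ k.+2.
Proof.
move=> b0; rewrite -[(a * b') *+ _]mulr_natl !exprVn !exprS expr0.
move: (k.+1%:R) (b ^+ k) (expf_neq0 k b0) => c bk bk0.
by field; rewrite b0 bk0.
Qed.

(** The next derivative requires the formula in a neighbourhood, and [d.[x] != 0] is an open
    condition. Common factors of [p] and [d] are allowed, so two functions can be put over one
    denominator. *)
Lemma derive1n_rational d p (f : K -> K^o) k (z : K) :
  (forall x, d.[x] != 0 -> f x = p.[x] / d.[x]) -> d.[z] != 0 ->
  derive1n k f z = (derive_num d p k).[z] / d.[z] ^+ k.+1.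
Proof.
move=> fE; elim: k z => [|k IHk] z dz; first by rewrite /= fE // expr1.
rewrite derive1nS derive1E.
set p_k := derive_num d p k in IHk *.
have dinv : is_derive z (1 : K) (fun x : K => (d.[x])^-1 : K^o)
    (- d.[z] ^- 2 *: d^`().[z]).
  have [dd <-] := is_derive_horner d z.
  by apply: DeriveDef; [exact: derivableV|rewrite deriveV].
have dpk := is_derive_horner p_k z.
have dprod := is_deriveM dpk (is_deriveX k.+1 dinv).
have fkE : \forall x \near z,
    ((horner p_k : K -> K^o) * (fun x : K => (d.[x])^-1 : K^o) ^+ k.+1) x =
    derive1n k f x.
  near=> x; rewrite IHk; last by near: x; exact: near_horner_neq0.
  by rewrite exprfctE /= -exprVn.
have [_ ->] := near_eq_is_derive fkE dprod.
have -> : (derive_num d p k.+1).[z] =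
    p_k^`().[z] * d.[z] - (p_k.[z] * d^`().[z]) *+ k.+1.
  by rewrite [LHS]hornerD hornerN hornerMn !hornerM.
rewrite exprfctE; exact: quotient_rule_step.
Unshelve. all: by end_near. Qed.
End RationalDerivative.

(** * Centred realisations as quotients of polynomials *)

Section Pencil.
Variable K : fieldType.
Implicit Types (p d : {poly K}) (G : ratfun K).

Lemma cross_rnum_rden G p d : G * d%:F = p%:F -> rnum G * d = p * rden G.
Proof.
move=> Gd; apply/eqP; rewrite -tofrac_eq !tofracM -Gd {2}[G]ratfunE.
by rewrite mulrAC divfK // tofrac_eq0 rden_neq0.
Qed.

(** A root of the reduced denominator [q] is not a root of [r], hence is a root of [d]. Values and
    absence of poles can thus be read off an unreduced quotient. *)
Lemma coprime_cross_root (p d r q : {poly K}) z :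
  coprimep r q -> r * d = p * q -> ~~ root d z ->
  ~~ root q z /\ r.[z] / q.[z] = p.[z] / d.[z].
Proof.
move=> rq e dz; have qz : ~~ root q z.
  apply/negP => qz; have := congr1 (horner^~ z) e.
  rewrite !hornerM (rootP qz) mulr0 => /eqP; rewrite mulf_eq0.
  rewrite coprimep_sym in rq.
  by rewrite (negPf (coprimep_root rq qz)) -rootE (negPf dz).
split=> //; apply/eqP; rewrite eqr_div // -?rootE //.
by rewrite -!hornerM e.
Qed.

(** The sign is opposite to that in [regular_pencil] and agrees with the matrix inverted in
    [centred_tf]. *)
Definition pencil n (A E : 'M[K]_n) : 'M[{poly K}]_n :=
  'X *: map_mx polyC E - map_mx polyC A.

Definition centred_num n l0 (A : 'M[K]_n) (B : 'cV[K]_n)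
    (C : 'rV[K]_n) D (E : 'M[K]_n) : {poly K} :=
  (map_mx polyC C *m \adj (pencil A E) *m map_mx polyC B) 0 0 * (l0%:P - 'X)
  + D%:P * \det (pencil A E).

Lemma regular_pencilE n (A E : 'M[K]_n) :
  regular_pencil A E = (\det (pencil A E) != 0).
Proof.
rewrite /regular_pencil /pencil -opprB -scaleN1r detZ mulf_eq0.
by rewrite expf_eq0 oppr_eq0 oner_eq0 andbF.
Qed.

Lemma horner_det_pencil n (A E : 'M[K]_n) z :
  (\det (pencil A E)).[z] = \det (z *: E - A).
Proof.
rewrite -horner_evalE -det_map_mx; congr (\det _); apply/matrixP => i j.
by rewrite !mxE /= /horner_eval !hornerE.
Qed.

Lemma centred_tfE n l0 (A : 'M[K]_n) B C D (E : 'M[K]_n) :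
  regular_pencil A E ->
  centred_tf (Some l0) A B C D E * (\det (pencil A E))%:F =
  (centred_num l0 A B C D E)%:F.
Proof.
rewrite regular_pencilE => reg; set d := \det _.
have cstE m1 m2 (M : 'M[K]_(m1, m2)) :
    map_mx (fun x => x%:P%:F) M =
    map_mx (@FracField.tofrac {poly K}) (map_mx polyC M).
  by rewrite -map_mx_comp.
rewrite /centred_tf !cstE -map_mxZ -map_mxB -/(pencil A E).
have dF : d%:F != 0 by rewrite tofrac_eq0.
rewrite /invmx unitmxE det_map_mx unitfE dF -map_mx_adj.
have mxZ (c : ratfun K) (X : 'M[ratfun K]_1) : (c *: X) 0 0 = c * X 0 0.
  by rewrite mxE.
rewrite -scalemxAr -scalemxAl -!map_mxM mxZ.
set q := _ *m map_mx polyC B.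
have -> : map_mx (@FracField.tofrac {poly K}) q 0 0 = (q 0 0)%:F by rewrite mxE.
rewrite mulrDl [X in X + _]mulrC -mulrA mulVKf // /centred_num.
by rewrite tofracD !tofracM tofracB.
Qed.

End Pencil.

Lemma map_pencil (K K' : fieldType) (f : {rmorphism K -> K'}) n
    (A E : 'M[K]_n) :
  map_mx (map_poly f) (pencil A E) = pencil (map_mx f A) (map_mx f E).
Proof.
by apply/matrixP => i j; rewrite !mxE rmorphB rmorphM /= map_polyX !map_polyC.
Qed.

Lemma map_centred_num (K K' : fieldType) (f : {rmorphism K -> K'}) n l0
    (A : 'M[K]_n) B C D E :
  map_poly f (centred_num l0 A B C D E) =
  centred_num (f l0) (map_mx f A) (map_mx f B) (map_mx f C) (f D) (map_mx f E).
Proof.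
have mapP m1 m2 (M : 'M[K]_(m1, m2)) :
    map_mx (map_poly f) (map_mx polyC M) = map_mx polyC (map_mx f M).
  by apply/matrixP => i j; rewrite !mxE map_polyC.
rewrite /centred_num rmorphD !rmorphM rmorphB /= map_polyX !map_polyC.
rewrite -det_map_mx map_pencil; congr (_ * _ + _).
rewrite -!mapP -map_pencil -map_mx_adj -!map_mxM.
by rewrite [RHS]mxE.
Qed.

(** * Degree bounds *)

Section Degrees.
Variable K : fieldType.

Lemma size_det_linear n (M : 'M[{poly K}]_n) :
  (forall i j, size (M i j) <= 2)%N -> (size (\det M) <= n.+1)%N.
Proof.
move=> M2; apply: leq_trans (size_sum _ _ _) _; apply/bigmax_leqP => s _.
rewrite size_Msign; apply: leq_trans (size_prod_leq _ _) _.
rewrite leq_subLR card_ord addnS ltnS.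
apply: leq_trans (_ : \sum_(i < n) 2 <= _)%N; first exact: leq_sum.
by rewrite sum_nat_const card_ord muln2 addnn.
Qed.

Lemma size_adj_linear n (M : 'M[{poly K}]_n) i j :
  (forall i j, size (M i j) <= 2)%N -> (size (\adj M i j) <= n)%N.
Proof.
case: n M i j => [|n] M i j M2; first by case: i.
rewrite mxE size_Msign; apply: size_det_linear => k l.
by rewrite !mxE.
Qed.

Lemma size_pencil n (A E : 'M[K]_n) i j : (size (pencil A E i j) <= 2)%N.
Proof.
rewrite !mxE -(polyCN (A i j)) mulrC size_MXaddC; case: ifP => // _.
by rewrite ltnS size_polyC_leq1.
Qed.

Lemma size_quadratic n (A E : 'M[K]_n) (b : 'cV[K]_n) (c : 'rV_n) i j :
  (size ((map_mx polyC c *m \adj (pencil A E) *m map_mx polyC b) i j)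
     <= n)%N.
Proof.
rewrite mxE; apply: leq_trans (size_sum _ _ _) _; apply/bigmax_leqP => k _.
rewrite [map_mx _ _ _ _]mxE mulrC mul_polyC.
apply: leq_trans (size_scale_leq _ _) _.
rewrite mxE; apply: leq_trans (size_sum _ _ _) _; apply/bigmax_leqP => l _.
rewrite [map_mx _ _ _ _]mxE mul_polyC; apply: leq_trans (size_scale_leq _ _) _.
exact/size_adj_linear/size_pencil.
Qed.

(** For invertible [E] the pencil is [E] times the characteristic matrix of [invmx E *m A]. *)
Lemma size_det_pencil n (A E : 'M[K]_n) :
  \det E != 0 -> size (\det (pencil A E)) = n.+1.
Proof.
move=> E0; have Eu : E \in unitmx by rewrite unitmxE unitfE.
have -> : pencil A E = map_mx polyC E *m char_poly_mx (invmx E *m A).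
  rewrite mulmxBr mul_mx_scalar -map_mxM mulKVmx //.
by rewrite det_mulmx det_map_mx mul_polyC size_scale // size_char_poly.
Qed.

Lemma size_centred_num n l0 (A : 'M[K]_n) B C D E :
  (size (centred_num l0 A B C D E) <= n.+1)%N.
Proof.
apply: leq_trans (size_polyD _ _) _; rewrite geq_max; apply/andP; split.
  apply: leq_trans (size_polyMleq _ _) _.
  rewrite -opprB size_polyN size_XsubC addn2 /= ltnS; exact: size_quadratic.
rewrite mul_polyC; apply: leq_trans (size_scale_leq _ _) _.
exact/size_det_linear/size_pencil.
Qed.

Lemma size_prod_linear_exp (I : finType) (P : pred I)
    (f : I -> {poly K}) (k : I -> nat) :
  (forall i, size (f i) <= 2)%N ->
  (size (\prod_(i | P i) f i ^+ k i)%R <= (\sum_(i | P i) k i).+1)%N.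
Proof.
move=> f2; elim/big_rec2: _ => [|i y x _ xy]; first by rewrite size_poly1.
apply: leq_trans (size_polyMleq _ _) _.
have := size_poly_exp_leq (f i) (k i); have := f2 i.
move: (size (f i ^+ k i)) (size (f i)) => s t t2 st.
have : ((t.-1 * k i).+1 <= (k i).+1)%N.
  by case: t t2 {st} => [|[|[|]]] //= _; rewrite ?mul0n ?mul1n.
by move: xy st; move: (size x) => ? ? ? ?; lia.
Qed.

(** Cancelling common factors lowers the degrees of numerator and denominator equally, so properness
    can be checked on any representation. *)
Lemma rnum_proper (H : ratfun K) (p d : {poly K}) :
  rnum H * d = p * rden H -> (size p <= size d)%N -> d != 0 ->
  (size (rnum H) <= size (rden H))%N.
Proof.
move=> e spd d0; have [->|r0] := eqVneq (rnum H) 0; first by rewrite size_poly0.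
have : (size (rnum H * d)%R <= (size p + size (rden H)).-1)%N.
  by rewrite e size_polyMleq.
rewrite size_mul //; move: d0; rewrite -size_poly_gt0.
move: (size (rnum H)) (size (rden H)) (size p) (size d) spd => *; lia.
Qed.

End Degrees.

(** * Reversed polynomials and poles at infinity *)

Section Reverse.
Variable K : fieldType.
Implicit Types (p d : {poly K}).

(** This is the reciprocal polynomial [u ^+ m * p(1 / u)] when [m] is at least the degree of [p]. *)
Definition revp m p : {poly K} := \poly_(i < m.+1) p`_(m - i).

Lemma horner_revp (K' : fieldType) (f : {rmorphism K -> K'}) m p u :
  (size p <= m.+1)%N -> u != 0 ->
  (map_poly f p).[u^-1] * u ^+ m = (map_poly f (revp m p)).[u].
Proof.
move=> sp u0; rewrite [_.[u^-1]](@horner_coef_wide _ m.+1); last first.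
  exact: leq_trans (size_poly _ _) sp.
rewrite [RHS](@horner_coef_wide _ m.+1); last first.
  exact: leq_trans (size_poly _ _) (size_poly _ _).
rewrite [RHS](reindex_inj rev_ord_inj) mulr_suml; apply: eq_bigr => i _.
have im : (i <= m)%N by rewrite -ltnS.
rewrite !coef_map coef_poly /= subSS ltnS leq_subr subKn // -mulrA.
congr (_ * _); rewrite -[X in _ * u ^+ X](subnKC im) exprD mulrA exprVn.
by rewrite mulVf ?mul1r ?expf_neq0.
Qed.

Lemma revp0 m p : (revp m p).[0] = p`_m.
Proof. by rewrite horner_coef0 coef_poly /= subn0. Qed.

(** Serves to compare [rsubst], which evaluates in the fraction field, with embedded polynomials. *)
Lemma horner_map_polyC (T : comNzRingType) (f : {rmorphism {poly K} -> T}) q :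
  (map_poly (f \o polyC) q).[f 'X] = f q.
Proof.
rewrite map_poly_comp horner_map /=.
by rewrite -[(map_poly _ _).[_]]/(q \Po 'X) comp_polyXr.
Qed.

Lemma revp_cross (K' : fieldType) (f : {rmorphism {poly K} -> K'}) m p d :
  (size p <= m.+1)%N -> (size d <= m.+1)%N -> f 'X != 0 -> f (revp m d) != 0 ->
  (map_poly (f \o polyC) p).[(f 'X)^-1] /
    (map_poly (f \o polyC) d).[(f 'X)^-1] * f (revp m d) = f (revp m p).
Proof.
move=> sp sd X0; rewrite -(horner_map_polyC f (revp m d)).
rewrite -(horner_map_polyC f (revp m p)) -!horner_revp //.
set a := _.[_]; set b := (map_poly _ _).[_]; set c := _ ^+ _ => bc0.
by rewrite mulrA divfK //; apply: contraNneq bc0 => ->; rewrite mul0r.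
Qed.

(** Reversal at the degree of [rden H] writes H(1 / lambda) as a quotient whose denominator takes at
    0 the leading coefficient of [rden H]. *)
Lemma rden_rsubst_inv (H : ratfun K) :
  (size (rnum H) <= size (rden H))%N ->
  ~~ root (rden (rsubst H ('X%:F)^-1)) 0.
Proof.
move=> sND; have rden0 := rden_neq0 H.
pose m := (size (rden H)).-1; have sm : size (rden H) = m.+1.
  by rewrite /m prednK // size_poly_gt0.
have D0 : ~~ root (revp m (rden H)) 0.
  by rewrite rootE revp0 -lead_coefE lead_coef_eq0.
have DF0 : (revp m (rden H))%:F != 0.
  by rewrite tofrac_eq0; apply: contraNneq D0 => ->; rewrite root0.
have X0 : 'X%:F != 0 :> ratfun K by rewrite tofrac_eq0 polyX_eq0.
rewrite sm in sND; have sD : (size (rden H) <= m.+1)%N by rewrite sm.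
have cross := revp_cross sND sD X0 DF0.
by case: (coprime_cross_root (coprimep_rnum_rden _) (cross_rnum_rden cross) D0).
Qed.
End Reverse.

(** * Limits at infinity and values of the moments *)

Section AtInfinity.
Local Open Scope classical_set_scope.
Variable R : realType.
Local Notation toC := (real_complex R).

Lemma cvg_inv_complex_infty :
  (fun z : R[i]^o => z^-1 : R[i]^o) @ @complex_infty R --> (0 : R[i]^o).
Proof.
apply/cvgrPdist_lt => e e0.
(* [complex_infty] asks for a real radius; a positive [e] in [R[i]] is real, so the real part loses
   nothing. *)
exists (complex.Re e^-1) => z ez.
have ee : toC (complex.Re e^-1) = e^-1.
  by apply: RRe_real; rewrite realE ltW // invr_gt0.
rewrite ee in ez; have z0 : 0 < `|z| by apply: lt_trans ez; rewrite invr_gt0.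
by rewrite sub0r normrN normfV invf_plt.
Qed.

Lemma continuous_horner_numField (K : numFieldType) (p : {poly K}) (z : K) :
  (horner p : K -> K^o) @ z --> (p.[z] : K^o).
Proof.
have [/derivable1_diffP/differentiable_continuous cp _] := is_derive_horner p z.
exact: cp.
Qed.

(** With u = 1 / z this is continuity at u = 0 of the quotient of reversed polynomials, whose
    denominator there is [lead_coef d]. *)
Lemma cvg_rational_infty (d p : {poly R[i]}) (f : R[i]^o -> R[i]^o) :
  d != 0 -> (size p <= size d)%N ->
  (forall x, d.[x] != 0 -> f x = p.[x] / d.[x]) ->
  f @ @complex_infty R --> (p`_(size d).-1 / lead_coef d : R[i]^o).
Proof.
move=> d0 spd fE; pose m := (size d).-1.
have sd : size d = m.+1 by rewrite /m prednK // size_poly_gt0.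
have cinv (q : {poly R[i]}) :
    (fun z : R[i]^o => (revp m q).[z^-1] : R[i]^o) @ @complex_infty R -->
      (q`_m : R[i]^o).
  rewrite -revp0; pose inv (z : R[i]^o) : R[i]^o := z^-1.
  apply: (@cvg_comp _ _ _ inv (horner (revp m q) : R[i]^o -> R[i]^o) _ _ _
    cvg_inv_complex_infty).
  exact: (@continuous_horner_numField R[i]).
have lead0 : lead_coef d != 0 by rewrite lead_coef_eq0.
have revE (q : {poly R[i]}) (z : R[i]) : (size q <= m.+1)%N -> z != 0 ->
    (revp m q).[z^-1] = q.[z] / z ^+ m.
  move=> sq z0; have := horner_revp idfun sq (invr_neq0 z0).
  by rewrite !map_poly_id // invrK exprVn => <-.
have near0 : \forall z \near @complex_infty R, z != 0.
  by exists 0 => z; rewrite normr_gt0.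
have cf : (fun z : R[i]^o => (revp m p).[z^-1] / (revp m d).[z^-1] : R[i]^o)
    @ @complex_infty R --> (p`_m / lead_coef d : R[i]^o).
  by apply: cvgM (cinv p) _; apply: cvgV => //; exact: (cinv d).
apply: cvg_trans cf; apply: near_eq_cvg.
have nd : \forall z \near @complex_infty R, (revp m d).[z^-1] != 0.
  exact: (cvgr_neq0 _ (cinv d)).
near=> z.
have z0 : z != 0 by near: z.
have : (revp m d).[z^-1] != 0 by near: z.
rewrite !revE ?sd // -?sd // => dz.
have dz0 : d.[z] != 0 by apply: contraNneq dz => ->; rewrite mul0r.
by rewrite fE // invf_div mulrA divfK // expf_neq0.
Unshelve. all: by end_near. Qed.

Section Moments.
Variables (G : ratfun R) (d p : {poly R[i]}).
Hypothesis GE : forall x, d.[x] != 0 -> evalC G x = p.[x] / d.[x].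

Lemma moment_finite k z : d.[z] != 0 ->
  moment G k (Some z) =
  (-1) ^+ k / k`!%:R * ((derive_num d p k).[z] / d.[z] ^+ k.+1).
Proof. by move=> dz; rewrite /moment (derive1n_rational k GE dz). Qed.

Lemma moment_infty k : d != 0 -> (size p <= size d)%N ->
  moment G k None = if k is 0 then p`_(size d).-1 / lead_coef d else 0.
Proof.
move=> d0 spd; rewrite /moment.
(* The derivative is again rational, with denominator [d ^+ k.+1], and proper by
   [size_derive_num]. *)
have cG : derive1n k (evalC G : R[i]^o -> R[i]^o) @ @complex_infty R -->
    ((derive_num d p k)`_((size (d ^+ k.+1)).-1)
      / lead_coef (d ^+ k.+1) : R[i]^o).
  apply: cvg_rational_infty.
  - by rewrite expf_neq0.
  - apply: leq_trans (size_derive_num k d0 spd) _.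
    have : (0 < size (d ^+ k.+1))%N by rewrite size_poly_gt0 expf_neq0.
    rewrite -size_exp; case: (size (d ^+ k.+1)) => //= s _.
    by rewrite -[s.+1]addn1 leq_add2l leq_b1.
  - move=> x; rewrite horner_exp expf_eq0 /= => dx.
    by rewrite (derive1n_rational k GE dx).
transitivity ((-1) ^+ k / k`!%:R * ((derive_num d p k)`_((size (d ^+ k.+1)).-1)
    / lead_coef (d ^+ k.+1)) : R[i]^o).
  have hausR : hausdorff_space (R[i]^o : topologicalType).
    exact: norm_hausdorff.
  rewrite /=; apply: (cvg_lim hausR).
  by apply: cvgM; [exact: cvg_cst | exact: cG].
case: k {cG} => [|k]; first by rewrite expr0 expr1 fact0 divr1 mul1r.
(* For positive order the strict degree bound makes the coefficient in the limit zero. *)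
have := size_derive_num k.+1 d0 spd; rewrite addn0 => sk.
by rewrite size_exp nth_default ?mul0r ?mulr0.
Qed.
End Moments.
End AtInfinity.

(** * Polynomial error identity, solvability and moment matching *)

(** This is [interpolation_error] over polynomials with [w = 'X - l0%:P], the factor [l0%:P - 'X]
    restored. The bound on [q] serves the degree count at infinity. *)
Lemma centred_num_error (K : fieldType) n nu l0 (A E : 'M[K]_n) (B : 'cV_n)
    (C : 'rV_n) D (S : 'M[K]_nu) (L : 'rV_nu) (Gv : 'cV_nu) (Pi : 'M[K]_(n, nu))
    (F := S - Gv *m L) (A_H := 1%:M + l0 *: F) :
  E *m Pi + B *m L = (A - l0 *: E) *m Pi *m S ->
  \det (pencil A_H F) != 0 ->
  exists2 q : {poly K}, (size q <= n)%N &
  centred_num l0 A B C D E * \det (pencil A_H F)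
    - centred_num l0 A_H Gv (C *m Pi) D F * \det (pencil A E) =
  q * (l0%:P - 'X) * \det (('X - l0%:P) *: map_mx polyC S - 1%:M).
Proof.
move=> sylv; set w := 'X - l0%:P.
have shift m (N M : 'M[K]_m) :
    pencil N M = w *: map_mx polyC M - map_mx polyC (N - l0 *: M).
  by apply/matrixP => i j; rewrite !mxE polyCB polyCM /w; ring.
have sylvP : map_mx polyC E *m map_mx polyC Pi +
    map_mx polyC B *m map_mx polyC L =
    map_mx polyC (A - l0 *: E) *m map_mx polyC Pi *m map_mx polyC S.
  by rewrite -!map_mxM -map_mxD sylv.
(* Recentring at [l0] turns [A_H] into the identity. *)
have pencilH : pencil A_H F =
    w *: (map_mx polyC S - map_mx polyC Gv *m map_mx polyC L) - 1%:M.
  by rewrite shift /A_H addrK map_mx1 map_mxB map_mxM.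
rewrite pencilH => detQ.
exists ((map_mx polyC C *m \adj (pencil A E)
  *m map_mx polyC (B - (A - l0 *: E) *m Pi *m Gv)) 0 0).
  exact: size_quadratic.
rewrite map_mxB !map_mxM shift mulrAC.
rewrite -(interpolation_error (map_mx polyC C) sylvP detQ).
rewrite /centred_num pencilH shift !map_mxM /w; ring.
Qed.

(** The map [X |-> M X S - E X] is an endomorphism of a finite-dimensional space, so injectivity
    gives surjectivity. *)
Lemma sylvester_unique_solution (K : fieldType) n nu (E M : 'M[K]_n)
    (S : 'M[K]_nu) (Z : 'M[K]_(n, nu)) :
  (forall X : 'M[K]_(n, nu), E *m X = M *m X *m S -> X = 0) ->
  exists! X : 'M[K]_(n, nu), E *m X + Z = M *m X *m S.
Proof.
move=> inj.
pose f := linfun (mulmxr S \o mulmx M) - linfun (mulmx E) : 'End('M[K]_(n, nu)).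
have fE X : f X = M *m X *m S - E *m X by rewrite add_lfunE opp_lfunE !lfunE.
have fB X Y : f (X - Y) = f X - f Y by rewrite linearB.
have eq0 X : f X = 0 -> X = 0.
  by rewrite fE => /subr0_eq ME; apply: inj.
have kerf : lker f == 0%VS.
  by apply/lker0P => X Y XY; apply/subr0_eq/eq0; rewrite fB XY subrr.
have /memv_imgP[X _ ZE] : Z \in limg f by rewrite lker0_limgf ?memvf.
exists X; split; first by rewrite ZE fE addrC subrK.
move=> Y YE; apply/subr0_eq/eq0; rewrite fB -ZE fE -YE addrAC subrr add0r.
exact: subrr.
Qed.

Section MomentMatching.
Variables (R : realType) (G H : ratfun R) (d p q : {poly R[i]}).
Hypothesis GE : forall x, d.[x] != 0 -> evalC G x = p.[x] / d.[x].
Hypothesis HE : forall x, d.[x] != 0 -> evalC H x = q.[x] / d.[x].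

(** Over a common denominator the derivative numerators differ by [derive_num d (p - q) j], which
    keeps a factor ['X - z%:P] because [j < m]. *)
Lemma moment_match_finite z m j :
  d.[z] != 0 -> ('X - z%:P) ^+ m %| p - q -> (j < m)%N ->
  moment G j (Some z) = moment H j (Some z).
Proof.
move=> dz dvd jm; rewrite (moment_finite GE) // (moment_finite HE) //.
congr (_ * (_ / _)); apply/eqP; rewrite -subr_eq0 -hornerN -hornerD.
rewrite -derive_numB -rootE root_factor_theorem -['X - _]expr1.
apply: dvdp_derive_num; apply: dvdp_trans dvd.
exact: dvdp_exp2l.
Qed.

(** Order zero compares the coefficients at the degree of [d], where [p - q] has none; moments of
    positive order vanish on both sides. *)
Lemma moment_match_infty j :
  (size p <= size d)%N -> (size q <= size d)%N ->
  (size (p - q)%R < size d)%N ->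
  moment G j None = moment H j None.
Proof.
move=> sp sq spq.
have d0 : d != 0 by rewrite -size_poly_gt0 (leq_ltn_trans _ spq).
rewrite (moment_infty GE) // (moment_infty HE) //; case: j => // .
congr (_ / _); apply/eqP; rewrite -subr_eq0 -coefB nth_default //.
by rewrite -ltnS prednK // size_poly_gt0.
Qed.

End MomentMatching.

Lemma evalC_cross (R : realType) (G : ratfun R) (d p : {poly R[i]}) x :
  map_poly (real_complex R) (rnum G) * d =
    p * map_poly (real_complex R) (rden G) ->
  d.[x] != 0 ->
  ~~ is_pole G (Some x) /\ evalC G x = p.[x] / d.[x].
Proof.
move=> e dx; apply: (coprime_cross_root _ e dx).
by rewrite coprimep_map coprimep_rnum_rden.
Qed.

(** * Real matrices with a complex Jordan form *)

Section RealSylvester.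
Variables (R : realType) (n nu alpha : nat) (lambda0 : R).
Variables (A E : 'M[R]_n) (mu : 'I_alpha -> ccomplex R) (n_ : 'I_alpha -> nat).
Local Notation toC := (real_complex R).
(** [moebius] is [None] only at [lambda0], so [odflt] returns the true image of every other
    point. *)
Local Notation theta := (fun i => odflt 0 (moebius lambda0%:C (mu i))).

(** The matrix is [theta i *: (A - z *: E)] at a finite point [z], and [- E] at infinity. *)
Lemma moebius_pencil_regular i :
  mu i != Some lambda0%:C -> ~~ gen_eigenvalue A E (mu i) ->
  \det (theta i *: map_mx toC (A - lambda0 *: E) - map_mx toC E) != 0.
Proof.
rewrite /gen_eigenvalue; case: (mu i) => [z|] /= zl reg.
  have zl0 : z - toC lambda0 != 0.
    by rewrite subr_eq0; apply: contraNneq zl => ->.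
  rewrite -[z == _]subr_eq0 (negPf zl0) /=.
  suff -> : (z - toC lambda0)^-1 *: map_mx toC (A - lambda0 *: E) - map_mx toC E
      = (z - toC lambda0)^-1 *: (map_mx toC A - z *: map_mx toC E).
    by rewrite detZ mulf_neq0 // expf_neq0 // invr_neq0.
  apply/matrixP => a b; rewrite !mxE rmorphB rmorphM /=; field.
  exact: zl0.
rewrite scale0r sub0r -scaleN1r detZ; apply: mulf_neq0.
- by rewrite expf_neq0 // oppr_eq0 oner_eq0.
- by rewrite det_map_mx fmorph_eq0.
Qed.

(** The Jordan form exists over [R[i]], so the equation is complexified and the conclusion pulled
    back along the injective [toC]. *)
Lemma real_sylvester_injective (nS : (\sum_i n_ i)%N = nu) (S : 'M[R]_nu)
    (X : 'M[R]_(n, nu)) :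
  map_mx toC S ~_{in unitmx} castmx (nS, nS) (Jord theta n_) ->
  (forall i, mu i != Some lambda0%:C) ->
  (forall i, ~~ gen_eigenvalue A E (mu i)) ->
  E *m X = (A - lambda0 *: E) *m X *m S -> X = 0.
Proof.
move=> S_sim mu0 mu_reg EX; apply: (@map_mx_inj _ _ toC); rewrite map_mx0.
apply: (sylvester_injective (char_poly_similar_Jord S_sim)) => [i|].
  exact: moebius_pencil_regular.
by rewrite -!map_mxM EX.
Qed.

End RealSylvester.

(** * The reduced model *)

Section Reduction.
Variables (R : realType) (n nu alpha : nat) (lambda0 : R).
Variables (mu : 'I_alpha -> ccomplex R) (n_ : 'I_alpha -> nat).
Local Notation toC := (real_complex R).
Local Notation theta := (fun i => odflt 0 (moebius lambda0%:C (mu i))).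
Variables (A E : 'M[R]_n) (B : 'cV[R]_n) (C : 'rV[R]_n) (D : R).
Variables (S : 'M[R]_nu) (L : 'rV[R]_nu) (Gv : 'cV[R]_nu) (Pi : 'M[R]_(n, nu)).
Let F := S - Gv *m L.
Let A_H : 'M[R]_nu := 1%:M + lambda0 *: F.
Let H := centred_tf (Some lambda0) A_H Gv (C *m Pi) D F.

Let l0 := toC lambda0.
Let dG := \det (pencil (map_mx toC A) (map_mx toC E)).
Let pG := centred_num l0 (map_mx toC A) (map_mx toC B) (map_mx toC C) (toC D)
  (map_mx toC E).
Let dH := \det (pencil (map_mx toC A_H) (map_mx toC F)).
Let pH := centred_num l0 (map_mx toC A_H) (map_mx toC Gv) (map_mx toC (C *m Pi))
  (toC D) (map_mx toC F).

Lemma realisation_cross (G : ratfun R) :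
  realisation G (Some lambda0%:C) A B C D E ->
  map_poly toC (rnum G) * dG = pG * map_poly toC (rden G).
Proof.
case=> reg GE.
have regC : regular_pencil (map_mx toC A) (map_mx toC E).
  rewrite regular_pencilE -map_pencil det_map_mx map_poly_eq0.
  by rewrite -regular_pencilE.
have := centred_tfE l0 (map_mx toC B) (map_mx toC C) (toC D) regC.
rewrite -GE /complexify -/pG -/dG => e; apply/eqP.
rewrite -tofrac_eq !tofracM -e mulrAC divfK // tofrac_eq0 map_poly_eq0.
exact: rden_neq0.
Qed.

(** At [lambda0] the pencil equals minus the identity, whatever [Gv] is. *)
Lemma reduced_regular : regular_pencil A_H F.
Proof.
rewrite regular_pencilE; apply/eqP => /(congr1 (horner^~ lambda0)).
rewrite horner_det_pencil horner0 /A_H opprD addrCA subrr addr0.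
rewrite -scaleN1r detZ det1 mulr1 => /eqP.
by rewrite expf_eq0 oppr_eq0 oner_eq0 andbF.
Qed.

Lemma reduced_cross_real :
  rnum H * \det (pencil A_H F) =
  centred_num lambda0 A_H Gv (C *m Pi) D F * rden H.
Proof. exact/cross_rnum_rden/centred_tfE/reduced_regular. Qed.

Lemma reduced_cross : map_poly toC (rnum H) * dH = pH * map_poly toC (rden H).
Proof.
rewrite /dH /pH -map_pencil det_map_mx -map_centred_num.
by rewrite -!rmorphM reduced_cross_real.
Qed.

Lemma reduced_neq0 : dH != 0.
Proof.
rewrite /dH -map_pencil det_map_mx map_poly_eq0 -regular_pencilE.
exact: reduced_regular.
Qed.

(** The determinant in [centred_num_error] splits into one factor per [mu i], which locates the
    zeros of the error. *)
Lemma reduced_error (nS : (\sum_i n_ i)%N = nu) :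
  map_mx toC S ~_{in unitmx} castmx (nS, nS) (Jord theta n_) ->
  E *m Pi + B *m L = (A - lambda0 *: E) *m Pi *m S ->
  exists2 q : {poly R[i]}, (size q <= n)%N &
  pG * dH - pH * dG =
  q * (l0%:P - 'X) * \prod_i (('X - l0%:P) * (theta i)%:P - 1) ^+ n_ i.
Proof.
move=> S_sim sylv.
have detS := @det_similar_Jord_pencil _ _ polyC _ _ _ _ _ _
  ('X - l0%:P) 1 S_sim.
rewrite -detS /pG /pH /dH /dG.
have sylvC : map_mx toC E *m map_mx toC Pi + map_mx toC B *m map_mx toC L =
    (map_mx toC A - l0 *: map_mx toC E) *m map_mx toC Pi *m map_mx toC S.
  by rewrite -map_mxZ -map_mxB -!map_mxM -map_mxD sylv.
have FC : map_mx toC F = map_mx toC S - map_mx toC Gv *m map_mx toC L.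
  by rewrite map_mxB map_mxM.
have AHC : map_mx toC A_H = 1%:M + l0 *: map_mx toC F.
  by rewrite map_mxD map_mxZ map_mx1.
have := @centred_num_error _ _ _ l0 _ _ _ (map_mx toC C) (toC D) _ _
  (map_mx toC Gv) _ sylvC.
rewrite -FC -AHC -map_mxM; apply; exact: reduced_neq0.
Qed.

End Reduction.

Theorem mainTheorem1 (R : realType) (G : ratfun R) (n : nat) (lambda0 : R)
    (A : 'M[R]_n) (B : 'cV[R]_n) (C : 'rV[R]_n) (D : R) (E : 'M[R]_n)
    (Gmin : minimal_realisation G (Some lambda0%:C) A B C D E)
    (n_deg : n = mcmillan G)
    (lambda0_nonpole : ~~ is_pole G (Some lambda0%:C))
    (nu : nat) (nu_gt0 : (0 < nu)%N) (nu_lt : (nu < n)%N)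
    (alpha : nat) (alpha_gt0 : (0 < alpha)%N)
    (n_ : 'I_alpha -> nat) (n_gt0 : forall i, (0 < n_ i)%N)
    (n_sum : (\sum_i n_ i)%N = nu)
    (mu : 'I_alpha -> ccomplex R) (mu_inj : injective mu)
    (mu_lambda0 : forall i, mu i != Some lambda0%:C)
    (mu_reg : forall i, ~~ gen_eigenvalue A E (mu i))
    (moment_neq0 : exists i : 'I_alpha, exists2 j : nat,
       (j < n_ i)%N & moment G j (mu i) != 0)
    (S : 'M[R]_nu) (L : 'rV[R]_nu)
    (S_sim : map_mx (real_complex R) S ~_{in unitmx}
       castmx (n_sum, n_sum)
         (Jord (fun i => odflt 0 (moebius lambda0%:C (mu i))) n_))
    (LS_obs : observable L S) :
  (exists! Pi : 'M[R]_(n, nu),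
     E *m Pi + B *m L = (A - lambda0 *: E) *m Pi *m S) /\
  (forall Pi : 'M[R]_(n, nu),
     E *m Pi + B *m L = (A - lambda0 *: E) *m Pi *m S ->
   forall Gv : 'cV[R]_nu,
     (forall i, ~~ gen_eigenvalue (S - Gv *m L) 1%:M
                  (moebius lambda0%:C (mu i))) ->
   let F := S - Gv *m L in
   let A_H := 1%:M + lambda0 *: F in
   let H := centred_tf (Some lambda0) A_H Gv (C *m Pi) D F in
   regular_pencil A_H F /\
   (forall i, ~~ is_pole H (mu i)) /\
   (forall (i : 'I_alpha) (j : nat), (j < n_ i)%N ->
      moment G j (mu i) = moment H j (mu i))).
Proof.
have inj := real_sylvester_injective S_sim mu_lambda0 mu_reg.
split; first exact: sylvester_unique_solution.
move=> Pi sylv Gv regF F A_H H.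
have [Greal _] := Gmin.
have crossG := realisation_cross Greal.
have crossH : map_poly (real_complex R) (rnum H) * _ = _ :=
  reduced_cross lambda0 C D S L Gv Pi.
have dH0 := reduced_neq0 lambda0 S L Gv.
have [q sq errE] := reduced_error C D Gv S_sim sylv.
rewrite -/F -/A_H in crossH dH0 errE.
set l0 := real_complex R lambda0 in crossG crossH errE.
set dG := \det (pencil (map_mx _ A) _) in crossG errE.
set dH := \det (pencil (map_mx _ A_H) _) in crossH dH0 errE.
set pG := centred_num _ _ _ _ _ _ in crossG errE.
set pH := centred_num _ _ _ _ _ _ in crossH errE.
pose theta i := odflt 0 (moebius lambda0%:C (mu i)).
(* At [z] the pole pencil of [H] is [z - l0] times F - 1 / (z - l0), nonsingular by [regF]. *)
have dHz i z : mu i = Some z -> dH.[z] != 0.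
  move=> muz; have := regF i; have := mu_lambda0 i; rewrite muz /=.
  rewrite -[(lambda0%:C)]/l0 => zl0.
  have {}zl0 : z - l0 != 0 by rewrite subr_eq0; apply: contraNneq zl0 => ->.
  rewrite -[z == _]subr_eq0 (negPf zl0) /= => detF.
  rewrite /dH horner_det_pencil.
  suff -> : z *: map_mx (real_complex R) F - map_mx (real_complex R) A_H =
     (z - l0) *: (map_mx (real_complex R) F -
        (z - l0)^-1 *: map_mx (real_complex R) 1%:M).
    by rewrite detZ mulf_neq0 // expf_neq0.
  have -> : map_mx (real_complex R) A_H =
      1%:M + l0 *: map_mx (real_complex R) F.
    by rewrite map_mxD map_mxZ map_mx1.
  rewrite scalerBr scalerA mulfV // scale1r scalerBl map_mx1 opprD.
  by rewrite [X in _ + X]addrC addrA.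
have regH := reduced_regular lambda0 S L Gv.
have detF i : mu i = None -> \det F != 0.
  move=> mui; have := regF i; rewrite mui /= scale0r subr0 det_map_mx.
  by rewrite fmorph_eq0.
split=> //; split=> [i|i j jn].
  case mui : (mu i) => [z|]; first by case: (evalC_cross crossH (dHz i z mui)).
  apply: rden_rsubst_inv.
  apply: rnum_proper (reduced_cross_real _ _ _ _ _ _ _) _ _.
    by rewrite size_det_pencil ?(detF i) // size_centred_num.
  by rewrite -regular_pencilE.
(* A common denominator makes the derivative numerators of [G] and [H] subtract. *)
pose d := dG * dH.
have GE x : d.[x] != 0 -> evalC G x = (pG * dH).[x] / d.[x].
  rewrite !hornerM mulf_eq0 negb_or => /andP[dGx dHx].
  have [_ ->] := evalC_cross crossG dGx.
  by rewrite -mulf_div divff // mulr1.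
have HE x : d.[x] != 0 -> evalC H x = (pH * dG).[x] / d.[x].
  rewrite !hornerM mulf_eq0 negb_or => /andP[dGx dHx].
  have [_ ->] := evalC_cross crossH dHx.
  by rewrite [dG.[x] * _]mulrC -mulf_div divff // mulr1.
case mui : (mu i) => [z|].
  apply: (moment_match_finite GE HE _ _ jn).
    rewrite hornerM mulf_neq0 ?(dHz i) // /dG horner_det_pencil.
    have := mu_reg i; rewrite mui /= -opprB -scaleN1r detZ mulf_eq0 negb_or.
    by case/andP.
  rewrite errE (bigD1 i) //= mulrCA dvdp_mulr //.
  have zl0 : z - l0 != 0.
    by rewrite subr_eq0; apply: contraNneq (mu_lambda0 i) => zl; rewrite mui zl.
  have thetaE : theta i = (z - l0)^-1.
    by rewrite /theta mui /= -[z == _]subr_eq0 (negPf zl0).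
  (* The error factor of index [i] is a scalar multiple of ['X - z%:P], so its power supplies
     multiplicity [n_ i]. *)
  have -> : ('X - l0%:P) * (theta i)%:P - 1 = (theta i)%:P * ('X - z%:P).
    have : (z - l0)%:P * (theta i)%:P = 1 by rewrite -polyCM thetaE mulfV.
    rewrite polyCB => e; rewrite -e; ring.
  by rewrite exprMn dvdp_mull.
have detE : \det E != 0 by have := mu_reg i; rewrite mui.
have detFi := detF i mui.
have sdG : size dG = n.+1 by rewrite size_det_pencil // det_map_mx fmorph_eq0.
have sdH : size dH = nu.+1 by rewrite size_det_pencil // det_map_mx fmorph_eq0.
have dG0 : dG != 0 by rewrite -size_poly_gt0 sdG.
have sd : size d = (n + nu).+1 by rewrite size_mul // sdG sdH addSn addnS.
apply: (moment_match_infty GE HE).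
- apply: leq_trans (size_polyMleq _ _) _; rewrite sd sdH addnS /= -addSn.
  by rewrite leq_add2r size_centred_num.
- apply: leq_trans (size_polyMleq _ _) _; rewrite sd sdG addnS /= addnC -addnS.
  by rewrite leq_add2l size_centred_num.
(* At infinity [theta i = 0], so the factor of index [i] is the constant [-1]. Since [n_ i] is
   positive, the degree of the error drops below [n + nu]. *)
rewrite errE sd ltnS (bigD1 i) //= mui /= polyC0 mulr0 sub0r.
set r := \prod_(_ | _) _.
have sr : (size r <= nu)%N.
  apply: leq_trans (size_prod_linear_exp _ _ _) _ => [k|].
    rewrite mulrBl -polyCM -addrA -polyCN -[1]/(1%:P) -polyCN -polyCD mulrC.
    rewrite mul_polyC; apply: leq_trans (size_polyD _ _) _; rewrite geq_max.
    rewrite (leq_trans (size_scale_leq _ _)) ?size_polyX //.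
    exact: leq_trans (size_polyC_leq1 _) _.
  by rewrite -n_sum [X in (_ <= X)%N](bigD1 i) //= -add1n leq_add2r.
have sl : size (l0%:P - 'X) = 2%N by rewrite -opprB size_polyN size_XsubC.
have s1 : (size ((-1 : {poly R[i]}) ^+ n_ i)%R <= 1)%N.
  by rewrite -signr_odd; case: odd; rewrite ?expr1 ?size_polyN size_poly1.
have leqM (u v : {poly R[i]}) a b : (size u <= a)%N -> (size v <= b)%N ->
    (size (u * v)%R <= (a + b).-1)%N.
  move=> ua vb; apply: leq_trans (size_polyMleq _ _) _.
  by rewrite -!subn1 leq_sub2r // leq_add.
have := leqM _ _ _ _ (leqM _ _ _ _ sq (eq_leq sl)) (leqM _ _ _ _ s1 sr).
move=> /leq_trans; apply.
by rewrite addn2 add1n.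
Qed.
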